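(* Let $(k_i)_{i\geq 1}$ be a sequence of integers with $k_i>1$ for all $i$, let $\mathcal{C}=\varprojlim_n\bigoplus_{i\leq n}\mathbb{Z}_{k_i}$ be the compact abelian group obtained as the projective limit along the projections onto initial factors, let $\mu_{\mathcal{C}}$ be its normalized Haar measure, and let $\widehat{\phi}\colon\mathcal{C}\to[0,1]$ be the natural map described in the context. Let $\mathcal{O}([0,1])$ denote the family of open subsets of $[0,1]$ and let $\lambda$ be Lebesgue measure on $[0,1]$. Then $\lambda\colon\mathcal{O}([0,1])\to[0,1]$ and $\mu_{\mathcal{C}}\circ\widehat{\phi}^{-1}\colon\mathcal{O}([0,1])\to[0,1]$ are the same mapping; that is, $\lambda(U)=\mu_{\mathcal{C}}(\widehat{\phi}^{-1}(U))$ for every open $U\subseteq[0,1]$.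
   Context: $\mathbb{Z}_{k}=\{0<1<\cdots<k-1\}$ is the cyclic group of order $k$ with its order inherited from $\mathbb{N}$. Elements of $\mathcal{C}$ are identified with sequences $(x_i)_{i\geq 1}$, $x_i\in\mathbb{Z}_{k_i}$, and $\mathcal{C}$ is totally ordered lexicographically: for $x\neq y$, $x<y$ iff $x_i<y_i$ at the first index $i$ where they differ. Let $K\mathcal{C}$ be the set of compact elements of the complete lattice $\mathcal{C}$, which is the set of sequences with only finitely many nonzero entries. The natural map is defined on $x\in K\mathcal{C}$ with $x_i=0$ for $i>n$ by $\widehat{\phi}(x)=\sum_{i\leq n}\frac{x_i}{k_1k_2\cdots k_i}$, and on arbitrary $x\in\mathcal{C}$ by $\widehat{\phi}(x)=\sup\{\widehat{\phi}(y)\mid y\in K\mathcal{C},\ y\leq x\}$; it is a continuous, monotone surjection onto $[0,1]$. *)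

(* Defs.v *)
From HB Require Import structures.
From mathcomp Require Import all_boot all_order all_algebra.
From mathcomp Require Import all_classical all_reals all_analysis.

Set Implicit Arguments.
Unset Strict Implicit.
Unset Printing Implicit Defensive.

Import Order.TTheory GRing.Theory Num.Theory.
Import numFieldNormedType.Exports.

Local Open Scope classical_set_scope.
Local Open Scope ring_scope.

Definition borel (G : topologicalZmodType) : Type := G.

HB.instance Definition _ (G : topologicalZmodType) := Choice.on (borel G).
HB.instance Definition _ (G : topologicalZmodType) :=
  isPointed.Build (borel G) (0 : G).
HB.instance Definition _ (G : topologicalZmodType) :=
  @isMeasurable.Build (sigma_display (@open G)) (borel G) <<s @open G >>
    (@sigma_algebra0 _ setT _) (@sigma_algebraC (borel G) _)
    (@sigma_algebra_bigcup _ setT _).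

(* Normalization is part of [probability]; the last two clauses are outer and
   inner regularity. *)
Definition is_normalized_haar (R : realType) (G : topologicalZmodType)
    (mu : probability (borel G) R) : Prop :=
  [/\ forall (x : G) (A : set (borel G)), measurable A ->
        mu [set x + y | y in (A : set G)] = mu A,
      forall A : set (borel G), measurable A ->
        mu A = ereal_inf [set mu U | U in [set U : set G | open U /\ A `<=` U]]
    & forall U : set G, open U ->
        mu U = ereal_sup [set mu K | K in [set K : set G | compact K /\ K `<=` U]]].

Definition directed (d : Order.disp_t) (T : porderType d) (D : set T) : Prop :=
  D !=set0 /\
  forall a b, D a -> D b -> exists c, [/\ D c, (a <= c)%O & (b <= c)%O].

Definition compact_elt (d : Order.disp_t) (T : porderType d) (x : T) : Prop :=
  forall D : set T, directed D -> forall s, supremums D s -> (x <= s)%O ->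
  exists2 y, D y & (x <= y)%O.

(* The projective limit of the finite discrete groups \bigoplus_(i < n) 'Z_(k i)
   along the truncations, its elements being identified with sequences of
   digits; by [Cseq_nbhsP] below, the product topology is the limit topology.
   The factors are indexed from 0: [k i] and [x i] are k_{i+1} and x_{i+1}.
   ['Z_m] has order m only for 1 < m. *)
Definition Cseq (k : nat -> nat) : Type :=
  prod_topology (fun i => discrete_topology 'Z_(k i)).

HB.instance Definition _ (k : nat -> nat) := Topological.on (Cseq k).

Section Cseq_group.
Variable k : nat -> nat.
Implicit Types x y : Cseq k.

Definition Cseq_zero : Cseq k := fun i => (0 : 'Z_(k i)).
Definition Cseq_opp x : Cseq k := fun i => - (x i : 'Z_(k i)).
Definition Cseq_add x y : Cseq k :=
  fun i => (x i : 'Z_(k i)) + (y i : 'Z_(k i)).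

Fact Cseq_addA : associative Cseq_add.
Proof. by move=> x y z; apply: functional_extensionality_dep => i; exact: addrA. Qed.
Fact Cseq_addC : commutative Cseq_add.
Proof. by move=> x y; apply: functional_extensionality_dep => i; exact: addrC. Qed.
Fact Cseq_add0 : left_id Cseq_zero Cseq_add.
Proof. by move=> x; apply: functional_extensionality_dep => i; exact: add0r. Qed.
Fact Cseq_addN : left_inverse Cseq_zero Cseq_opp Cseq_add.
Proof. by move=> x; apply: functional_extensionality_dep => i; exact: addNr. Qed.

HB.instance Definition _ := GRing.isZmodule.Build (Cseq k)
  Cseq_addA Cseq_addC Cseq_add0 Cseq_addN.

Lemma Cseq_nbhsP x (A : set (Cseq k)) : nbhs x A <->
  exists n, [set y : Cseq k | forall i, (i < n)%N -> y i = x i] `<=` A.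
Proof.
split.
  pose F : set_system (Cseq k) := filter_from [set: nat]
    (fun n => [set y : Cseq k | forall i, (i < n)%N -> y i = x i]).
  have FF : Filter F.
    apply: filter_from_filter; first by exists 0%N.
    move=> m n _ _; exists (maxn m n) => // y yE.
    by split => i ilt; apply: yE; rewrite leq_max ilt ?orbT.
  have Fx : F --> x.
    apply/cvg_sup => i U [V] [[W] oW <-] /= Wx WU.
    exists i.+1 => // y yE; apply: WU; rewrite /= yE//.
  by move=> /Fx [n _ sub]; exists n.
move=> [n /filterS]; apply.
elim: n => [|n IH]; first by apply: filterS filterT => y _ i.
have xn : nbhs x [set y : Cseq k | y n = x n].
  have := @proj_continuous _ (fun i => discrete_topology 'Z_(k i)) n x.
  move=> /(_ [set x n]); apply.
  by rewrite nbhs_principalE; apply/principal_filterP.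
apply: filterS (filterI IH xn) => y [ylt yn] i.
by rewrite ltnS leq_eqVlt => /predU1P[->|/ylt].
Qed.

Fact Cseq_sub_continuous : continuous (fun z : Cseq k * Cseq k => z.1 - z.2).
Proof.
move=> [x y] A /Cseq_nbhsP[n sub] /=.
pose cyl (z : Cseq k) := [set w : Cseq k | forall i, (i < n)%N -> w i = z i].
exists (cyl x, cyl y).
  by split; apply/Cseq_nbhsP; exists n.
move=> [x' y'] /= [xx' yy']; apply: sub => i ilt /=.
by congr (_ - _); [apply: xx'|apply: yy'].
Qed.

HB.instance Definition _ :=
  PreTopologicalNmodule_isTopologicalZmodule.Build (Cseq k) Cseq_sub_continuous.

Lemma Cseq_compact : compact [set: Cseq k].
Proof.
have fin i : finite_set [set: discrete_topology 'Z_(k i)] by exact: finite_finset.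
have := tychonoff (fun i => finite_compact (fin i)).
by congr (compact _); rewrite eqEsubset.
Qed.

Lemma Cseq_hausdorff : hausdorff_space (Cseq k).
Proof. by apply: hausdorff_product => i; exact: discrete_hausdorff. Qed.

End Cseq_group.

Fact lex_display : Order.disp_t. Proof. exact: Order.Disp tt tt. Qed.

Section Cseq_order.
Variable k : nat -> nat.
Implicit Types x y z : Cseq k.

Definition Cseq_lt x y : bool :=
  `[< exists i, (forall j, (j < i)%N -> x j = y j) /\
                ((x i : 'Z_(k i)) < (y i : 'Z_(k i)))%N >].

Definition Cseq_le x y : bool := (x == y) || Cseq_lt x y.

Fact Cseq_lt_irr x : Cseq_lt x x = false.
Proof. by apply/asboolP => -[i [_]]; rewrite ltnn. Qed.

Fact Cseq_lt_trans : transitive Cseq_lt.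
Proof.
move=> y x z /asboolP[i [xy xyi]] /asboolP[j [yz yzj]]; apply/asboolP.
have [ij|ji|ij] := ltngtP i j.
- exists i; split=> [l li|]; last by rewrite -(yz _ ij).
  by rewrite xy// yz// (ltn_trans li).
- exists j; split=> [l lj|]; last by rewrite (xy _ ji).
  by rewrite xy ?yz// (ltn_trans lj).
- subst j; exists i; split=> [l li|]; first by rewrite xy// yz.
  exact: ltn_trans yzj.
Qed.

Fact Cseq_lt_total x y : [|| x == y, Cseq_lt x y | Cseq_lt y x].
Proof.
case: eqVneq => //= /eqP xy.
have ex : exists i, x i != y i.
  apply: contra_notP xy => /forallNP xy.
  by apply: functional_extensionality_dep => i; apply/eqP/negPn/negP/xy.
case: (ex_minnP ex) => i xyi imin.
have xyj j : (j < i)%N -> x j = y j.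
  by move=> ji; apply/eqP; apply: contraLR ji => /imin; rewrite -leqNgt.
have := xyi; rewrite -(inj_eq val_inj) neq_ltn => /orP[] lti; apply/orP.
- by left; apply/asboolP; exists i.
- by right; apply/asboolP; exists i; split=> // j /xyj.
Qed.

Fact Cseq_lt_def x y : Cseq_lt x y = (y != x) && Cseq_le x y.
Proof.
rewrite /Cseq_le [x == y]eq_sym.
by case: eqVneq => //= ->; rewrite Cseq_lt_irr.
Qed.

Fact Cseq_le_refl : reflexive Cseq_le.
Proof. by move=> x; rewrite /Cseq_le eqxx. Qed.

Fact Cseq_le_anti : antisymmetric Cseq_le.
Proof.
move=> x y /andP[/orP[/eqP//|xy] /orP[/eqP//|/(Cseq_lt_trans xy)]].
by rewrite Cseq_lt_irr.
Qed.

Fact Cseq_le_trans : transitive Cseq_le.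
Proof.
move=> y x z /orP[/eqP->//|xy] /orP[/eqP<-|/(Cseq_lt_trans xy) xz].
  by rewrite /Cseq_le xy orbT.
by rewrite /Cseq_le xz orbT.
Qed.

Fact Cseq_le_total : total Cseq_le.
Proof.
by move=> x y; rewrite /Cseq_le; case/or3P: (Cseq_lt_total x y) => ->; rewrite ?orbT.
Qed.

HB.instance Definition _ := Order.isPOrder.Build lex_display (Cseq k)
  Cseq_lt_def Cseq_le_refl Cseq_le_anti Cseq_le_trans.
HB.instance Definition _ :=
  Order.POrder_isTotal.Build lex_display (Cseq k) Cseq_le_total.

Lemma Cseq_ltP x y : reflect
  (exists i, (forall j, (j < i)%N -> x j = y j) /\
             ((x i : 'Z_(k i)) < (y i : 'Z_(k i)))%N) (x < y)%O.
Proof. exact: asboolP. Qed.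

Lemma compact_eltP x :
  compact_elt x <-> exists n, forall i, (n <= i)%N -> x i = (0 : 'Z_(k i)).
Proof.
pose trunc n : Cseq k := fun i => if (i < n)%N then x i else (0 : 'Z_(k i)).
split.
  move=> cx; pose D := range trunc.
  have le_tr m n : (m <= n)%N -> (trunc m <= trunc n)%O.
    move=> mn; rewrite leNgt; apply/Cseq_ltP => -[i [_]].
    rewrite /trunc; case: (ltnP i m) => // im.
    by rewrite (leq_trans im)// ltnn.
  have le_x n : (trunc n <= x)%O.
    rewrite leNgt; apply/Cseq_ltP => -[i [_]].
    by rewrite /trunc; case: ifP => _; rewrite ?ltnn.
  have [||y [n _ <-] xy] := cx D _ x _ (lexx x).
  - split; first by exists (trunc 0%N), 0%N.
    move=> _ _ [m _ <-] [n _ <-]; exists (trunc (maxn m n)).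
    by split; [exists (maxn m n)|exact/le_tr/leq_maxl|exact/le_tr/leq_maxr].
  - split=> [_ [n _ <-]//|z ubz]; rewrite leNgt; apply/Cseq_ltP => -[i [zx zxi]].
    have : (z < trunc i.+1)%O.
      apply/Cseq_ltP; exists i; rewrite /trunc ltnSn; split=> // j ji.
      by rewrite zx// ltnS ltnW.
    by apply/negP; rewrite -leNgt; apply: ubz; exists i.+1.
  - have -> : x = trunc n by apply/le_anti; rewrite xy le_x.
    by exists n => i ni; rewrite /trunc ltnNge ni.
move=> [n]; elim: n => [|n IH] in x trunc *.
  move=> x0 D [[d Dd] _] s _ _; exists d => //.
  by rewrite leNgt; apply/Cseq_ltP => -[i [_]]; rewrite x0.
move=> x0; have [xn0|xn0] := eqVneq (x n) (0 : 'Z_(k n)).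
  by apply: IH => i; rewrite leq_eqVlt => /predU1P[<-//|]; exact: x0.
move=> D [_ _] s [_ lubs] xs; apply: contrapT => /forall2NP nD.
pose p : Cseq k := fun i => if (i < n)%N then x i else
  if i == n then inZp (x i : 'Z_(k i)).-1 else (ord_max : 'Z_(k i)).
have xn_gt0 : (0 < (x n : 'Z_(k n)))%N.
  by rewrite lt0n; move: xn0; rewrite -(inj_eq val_inj).
have pn : (p n : 'Z_(k n)) = (x n : 'Z_(k n)).-1 :> nat.
  rewrite /p ltnn eqxx /= modn_small//.
  exact: leq_ltn_trans (leq_pred _) (ltn_ord _).
have px : (p < x)%O.
  apply/Cseq_ltP; exists n; split=> [j jn|]; first by rewrite /p jn.
  by rewrite pn prednK.
suff /lubs sp : ubound D p by have := le_lt_trans (le_trans xs sp) px; rewrite ltxx.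
move=> d Dd; have [//|] := nD d.
move/negP; rewrite -ltNge => dx; rewrite leNgt; apply/negP => pd.
case/Cseq_ltP: dx => i [dx dxi]; case/Cseq_ltP: pd => j [pd pdj].
have pE l : (l < n)%N -> p l = x l by rewrite /p => ->.
have in_ : (i <= n)%N by rewrite leqNgt; apply/negP => ni; rewrite x0 in dxi.
have [jn|nj|jn] := ltngtP j n.
- have [ji|ij|ij] := ltngtP j i.
  + by rewrite (pE _ jn) dx// ltnn in pdj.
  + by rewrite -pd// (pE _ (ltn_trans ij jn)) ltnn in dxi.
  + by rewrite ij (pE i) -?ij// in pdj dxi; have := ltn_trans pdj dxi; rewrite ltnn.
- have := in_; rewrite leq_eqVlt => /predU1P[iEn|ilt].
    subst i; have pj : p j = ord_max by rewrite /p ltnNge (ltnW nj)/= gtn_eqF.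
    by move: pdj; rewrite pj ltnNge -ltnS ltn_ord.
  by rewrite -pd ?(ltn_trans ilt)// (pE _ ilt) ltnn in dxi.
- subst j; have := in_; rewrite leq_eqVlt => /predU1P[iEn|ilt].
    subst i; rewrite pn in pdj.
    by have := leq_ltn_trans pdj dxi; rewrite prednK// ltnn.
  by rewrite -pd// (pE _ ilt) ltnn in dxi.
Qed.

End Cseq_order.

Section natural_map.
Variables (R : realType) (k : nat -> nat).
Implicit Types x y : Cseq k.

Definition phi_term x (i : nat) : R :=
  ((x i : 'Z_(k i)) : nat)%:R / (\prod_(j < i.+1) k j)%:R.

(* [\sum_(i \in setT)] is the finite sum over the support of the summand
   (and 0 when this support is infinite, which [phihat] never uses). *)
Definition phi_compact x : R := \sum_(i \in [set: nat]) phi_term x i.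

Definition phihat x : R :=
  sup [set phi_compact y | y in [set y : Cseq k | compact_elt y /\ (y <= x)%O]].

Lemma phi_compactE n x : (forall i, (n <= i)%N -> x i = (0 : 'Z_(k i))) ->
  phi_compact x = \sum_(i < n) phi_term x i.
Proof.
move=> x0; rewrite fsbig_ord; symmetry; apply: fsbig_widen => // i [_ /=].
by move/negP; rewrite -leqNgt => /x0 xi; rewrite /phi_term xi mul0r.
Qed.

Hypothesis k_gt1 : forall i, (1 < k i)%N.

Let P n : R := (\prod_(j < n) k j)%:R.

Let P_gt0 n : 0 < P n.
Proof. by rewrite ltr0n prodn_gt0// => i; rewrite (ltn_trans _ (k_gt1 i)). Qed.

Let phi_step x n : phi_term x n <= (P n)^-1 - (P n.+1)^-1.
Proof.
have kn0 : 0 < (k n)%:R :> R by rewrite ltr0n (ltn_trans _ (k_gt1 n)).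
have PS : P n.+1 = P n * (k n)%:R by rewrite /P big_ord_recr natrM.
have -> : (P n)^-1 = (k n)%:R / P n.+1.
  by rewrite PS invfM mulrCA mulfV ?mulr1// gt_eqF.
rewrite /phi_term -/(P n.+1) -[X in _ - X]mul1r -mulrBl.
rewrite ler_pM2r ?invr_gt0// lerBrDr natr1 ler_nat.
by rewrite -[X in (_ < X)%N](Zp_cast (k_gt1 n)); exact: ltn_ord.
Qed.

Let phi_term_ge0 x i : 0 <= phi_term x i.
Proof. by rewrite divr_ge0. Qed.

Let phi_tail x m n : (m <= n)%N ->
  \sum_(m <= i < n) phi_term x i <= (P m)^-1 - (P n)^-1.
Proof.
move=> mn; rewrite -opprB -(telescope_sumr (fun i => (P i)^-1) mn) -sumrN.
by apply: ler_sum => i _; rewrite opprB phi_step.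
Qed.

Lemma phi_compact_ge0 x : compact_elt x -> 0 <= phi_compact x.
Proof.
by move=> /compact_eltP[n x0]; rewrite (phi_compactE x0) sumr_ge0.
Qed.

Lemma phi_compact_le1 x : compact_elt x -> phi_compact x <= 1.
Proof.
move=> /compact_eltP[n x0]; rewrite (phi_compactE x0) -(big_mkord xpredT).
apply: le_trans (phi_tail _ (leq0n n)) _.
by rewrite {1}/P big_ord0 invr1 gerBl invr_ge0 ltW.
Qed.

Lemma phi_compact_le x y : compact_elt x -> compact_elt y -> (x <= y)%O ->
  phi_compact x <= phi_compact y.
Proof.
move=> /compact_eltP[m xm] /compact_eltP[n yn].
rewrite le_eqVlt => /predU1P[->//|/Cseq_ltP[i [xy xyi]]].
pose N := maxn i.+1 (maxn m n).
have iN : (i < N)%N by rewrite leq_maxl.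
have xN : phi_compact x = \sum_(0 <= i < N) phi_term x i.
  rewrite big_mkord; apply: phi_compactE => l Nl; apply: xm.
  by rewrite (leq_trans _ Nl)// !leq_max leqnn !orbT.
have yN : phi_compact y = \sum_(0 <= i < N) phi_term y i.
  rewrite big_mkord; apply: phi_compactE => l Nl; apply: yn.
  by rewrite (leq_trans _ Nl)// !leq_max leqnn !orbT.
have splitE z : \sum_(0 <= j < N) phi_term z j = \sum_(0 <= j < i) phi_term z j
    + (phi_term z i + \sum_(i.+1 <= j < N) phi_term z j).
  by rewrite -(big_ltn iN) -big_cat_nat//= ltnW.
rewrite xN yN !splitE.
apply: lerD.
  rewrite le_eqVlt; apply/orP; left; apply/eqP/eq_big_nat => j /andP[_ ji].
  by rewrite /phi_term xy.
apply: (@le_trans _ _ (phi_term x i + (P i.+1)^-1)).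
  rewrite lerD2l; apply: le_trans (phi_tail _ iN) _.
  by rewrite gerBl invr_ge0 ltW.
apply: (@le_trans _ _ (phi_term y i)); last by rewrite lerDl sumr_ge0.
rewrite /phi_term -/(P i.+1) -[X in _ + X]mul1r -mulrDl.
by rewrite ler_pM2r ?invr_gt0// natr1 ler_nat.
Qed.

Let phi_set x :=
  [set phi_compact y | y in [set y : Cseq k | compact_elt y /\ (y <= x)%O]].

Let phi_set_ub x : ubound (phi_set x) 1.
Proof. by move=> _ [y [cy _] <-]; exact: phi_compact_le1. Qed.

Lemma phihat_compact x : compact_elt x -> phihat x = phi_compact x.
Proof.
move=> cx; apply/eqP; rewrite eq_le; apply/andP; split.
  apply: ge_sup; first by exists (phi_compact x), x.
  by move=> _ [y [cy yx] <-]; exact: phi_compact_le.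
apply: ub_le_sup; first by exists 1; exact: phi_set_ub.
by exists x.
Qed.

Lemma phihat_itv x : phihat x \in `[0, 1].
Proof.
have c0 : compact_elt (0 : Cseq k) by apply/compact_eltP; exists 0%N.
have x0 : phi_set x (phi_compact 0).
  exists 0 => //; split=> //.
  by rewrite leNgt; apply/Cseq_ltP => -[i []].
rewrite in_itv/=; apply/andP; split.
  apply: le_trans (phi_compact_ge0 c0) _.
  by apply: ub_le_sup => //; exists 1; exact: phi_set_ub.
by apply: ge_sup; [exists (phi_compact 0)|exact: phi_set_ub].
Qed.

End natural_map.

(* Main.v *)
(** Let P_n = k_1 ... k_n and let v_n(x) < P_n be the integer whose mixed-radix
    digits are x_1, ..., x_n.  The fibers of v_n are the P_n cosets of an open
    subgroup, so each has Haar measure 1 / P_n, while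
    v_n(x) / P_n <= phihat x <= (v_n(x) + 1) / P_n.  Hence the Haar measure of
    [phihat < t] is within 2 / P_n of t for every n, so the image measure agrees
    with Lebesgue measure on half-lines. *)
Require Import Defs.
From HB Require Import structures.
From mathcomp Require Import all_boot all_order all_algebra.
From mathcomp Require Import all_classical all_reals all_analysis.
From mathcomp Require Import measurable_realfun lra.

Set Implicit Arguments.
Unset Strict Implicit.
Unset Printing Implicit Defensive.

Import Order.TTheory GRing.Theory Num.Theory.
Import numFieldNormedType.Exports.

Local Open Scope classical_set_scope.
Local Open Scope ring_scope.

(** * Mixed-radix prefixes, cylinders and truncations *)

Section prefix.
Variable k : nat -> nat.
Implicit Types x y : Cseq k.

Definition prefix_card n : nat := (\prod_(j < n) k j)%N.

Fixpoint prefix_value x n : nat :=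
  if n is m.+1 then (prefix_value x m * k m + (x m : 'Z_(k m)))%N else 0%N.

(** These are the basic neighbourhoods of [x] and the cosets of the open subgroup [cylinder 0 n]. *)
Definition cylinder x n : set (Cseq k) :=
  [set y | forall i, (i < n)%N -> y i = x i].

Definition truncation x n : Cseq k :=
  fun i => if (i < n)%N then x i else (0 : 'Z_(k i)).

Lemma prefix_cardS n : prefix_card n.+1 = (prefix_card n * k n)%N.
Proof. by rewrite /prefix_card big_ord_recr. Qed.

Lemma eq_prefix_value x y n : (forall i, (i < n)%N -> x i = y i) ->
  prefix_value x n = prefix_value y n.
Proof.
elim: n => //= n IH xy; rewrite IH ?xy// => i ilt.
by rewrite xy// (ltn_trans ilt).
Qed.

Lemma cylinder_open x n : open (cylinder x n).
Proof.
rewrite openE => y yx; apply/Cseq_nbhsP; exists n => z zy i ilt.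
by rewrite zy// yx.
Qed.

Lemma cylinder_shift x n :
  [set x + y | y in cylinder 0 n] = cylinder x n.
Proof.
rewrite eqEsubset; split=> [_ [y y0 <-] i ilt|y yx].
  have -> : (x + y) i = (x i : 'Z_(k i)) + (y i : 'Z_(k i)) by [].
  by rewrite y0// addr0.
exists (y - x); last by rewrite addrC subrK.
move=> i ilt; have -> : (y - x) i = (y i : 'Z_(k i)) - (x i : 'Z_(k i)) by [].
by rewrite yx// subrr.
Qed.

Lemma truncation_compact x n : compact_elt (truncation x n).
Proof.
by apply/compact_eltP; exists n => i ni; rewrite /truncation ltnNge ni.
Qed.

Lemma truncation_le x n : (truncation x n <= x)%O.
Proof.
rewrite leNgt; apply/Cseq_ltP => -[i [_]].
by rewrite /truncation; case: ifP => _; rewrite ?ltnn.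
Qed.

Lemma truncation_homo x y n : (x <= y)%O -> (truncation x n <= truncation y n)%O.
Proof.
move=> xy; rewrite leNgt; apply: contraTN xy => /Cseq_ltP[i [yx yxi]].
rewrite -ltNge; apply/Cseq_ltP; exists i.
move: yxi; rewrite /truncation; case: (ltnP i n) => [ilt yxi|_]; last by rewrite ltnn.
split=> // j ji.
by have := yx _ ji; rewrite /truncation (ltn_trans ji ilt).
Qed.

Lemma truncation_value x n : prefix_value (truncation x n) n = prefix_value x n.
Proof. by apply: eq_prefix_value => i ilt; rewrite /truncation ilt. Qed.

Hypothesis k_gt1 : forall i, (1 < k i)%N.

Lemma digit_lt x i : ((x i : 'Z_(k i)) < k i)%N.
Proof. by rewrite -[X in (_ < X)%N](Zp_cast (k_gt1 i)) ltn_ord. Qed.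

(** Each factor is at least 2. The bound supplies both the positivity and the divergence of
    [prefix_card]. *)
Lemma prefix_card_gt n : (n < prefix_card n)%N.
Proof.
elim: n => [|n IH]; first by rewrite /prefix_card big_ord0.
rewrite prefix_cardS; apply: (leq_ltn_trans IH).
by rewrite ltn_Pmulr// (leq_ltn_trans _ IH).
Qed.

Lemma prefix_value_lt x n : (prefix_value x n < prefix_card n)%N.
Proof.
elim: n => [|n IH]; first by rewrite /prefix_card big_ord0.
rewrite prefix_cardS /=; apply: (@leq_trans ((prefix_value x n).+1 * k n)).
  by rewrite mulSn addnC ltn_add2r digit_lt.
by rewrite leq_mul2r IH orbT.
Qed.

(** Euclidean division by [k n] recovers the shorter prefix as the quotient and the last digit as
    the remainder. *)
Lemma prefix_value_inj x y n : prefix_value x n = prefix_value y n ->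
  forall i, (i < n)%N -> x i = y i.
Proof.
elim: n => //= n IH E.
have kn0 : (0 < k n)%N by rewrite (ltn_trans _ (k_gt1 n)).
have E1 : prefix_value x n = prefix_value y n.
  by have := congr1 (divn^~ (k n)) E; rewrite !divnMDl// !divn_small ?digit_lt// !addn0.
move=> i; rewrite ltnS leq_eqVlt => /predU1P[->|]; last exact: IH.
by apply: val_inj; move: E; rewrite E1 => /addnI.
Qed.

Lemma prefix_value_surj n m : (m < prefix_card n)%N ->
  exists x, prefix_value x n = m.
Proof.
elim: n m => [|n IH] m; first by rewrite /prefix_card big_ord0; case: m => // _; exists 0.
have kn0 : (0 < k n)%N by rewrite (ltn_trans _ (k_gt1 n)).
rewrite prefix_cardS -ltn_divLR// => /IH [x xm].
exists (fun i => if i == n then inZp (m %% k n) else x i) => /=.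
rewrite eqxx (@eq_prefix_value _ x) => [|i ilt]; last by rewrite ltn_eqF.
by rewrite xm/= (modn_small (m := m %% k n)) ?Zp_cast ?ltn_mod// -divn_eq.
Qed.

Lemma prefix_value_fiber x n :
  [set y | prefix_value y n = prefix_value x n] = cylinder x n.
Proof.
by rewrite eqEsubset; split=> [y /prefix_value_inj//|y]; exact: eq_prefix_value.
Qed.

(** * Bounds on [phihat] by prefixes, and its measurability *)

Variable R : realType.

Lemma phi_partial_sum x n :
  \sum_(i < n) phi_term R x i = (prefix_value x n)%:R / (prefix_card n)%:R.
Proof.
elim: n => [|n IH]; first by rewrite big_ord0 mul0r.
rewrite big_ord_recr/= IH /phi_term -/(prefix_card n.+1) prefix_cardS.
have kn0 : (k n)%:R != 0 :> R by rewrite pnatr_eq0 -lt0n (ltn_trans _ (k_gt1 n)).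
by rewrite natrD mulrDl !natrM -mulf_div divff ?mulr1.
Qed.

(** Right endpoints of the nested radix intervals: a digit is at most [k j - 1], so refining a
    prefix never passes the old right endpoint. *)
Lemma prefix_value_upper_nonincr x m n : (m <= n)%N ->
  (prefix_value x n).+1%:R / (prefix_card n)%:R <=
  (prefix_value x m).+1%:R / (prefix_card m)%:R :> R.
Proof.
move=> /subnK <-; elim: (n - m)%N => // {}n IH.
apply: le_trans IH; rewrite addSn prefix_cardS.
have P0 j : 0 < (prefix_card j)%:R :> R.
  by rewrite ltr0n (leq_ltn_trans _ (prefix_card_gt j)).
set j := (n + m)%N.
have kj0 : 0 < (k j)%:R :> R by rewrite ltr0n (ltn_trans _ (k_gt1 j)).
rewrite natrM ler_pdivrMr ?mulr_gt0// mulrA divfK ?gt_eqF//.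
by rewrite -natrM ler_nat /= mulSn addnC ltn_add2r digit_lt.
Qed.

(** The left side is [phi_compact] of [truncation x n], a compact element below [x]. *)
Lemma phihat_ge x n :
  (prefix_value x n)%:R / (prefix_card n)%:R <= phihat R x.
Proof.
rewrite -truncation_value -phi_partial_sum -phi_compactE; last first.
  by move=> i ni; rewrite /truncation ltnNge ni.
apply: ub_le_sup.
  by exists 1 => _ [y [cy _] <-]; exact: phi_compact_le1.
by exists (truncation x n) => //; split; [exact: truncation_compact|exact: truncation_le].
Qed.

Lemma phihat_le x n :
  phihat R x <= (prefix_value x n).+1%:R / (prefix_card n)%:R.
Proof.
apply: ge_sup.
  exists (phi_compact R (truncation x n)), (truncation x n) => //.
  by split; [exact: truncation_compact|exact: truncation_le].
move=> _ [y [/compact_eltP[m ym] yx] <-].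
have P0 : 0 < (prefix_card n)%:R :> R.
  by rewrite ltr0n (leq_ltn_trans _ (prefix_card_gt n)).
(* At level [N] all nonzero digits of [y] are seen and the level [n] is refined, so the right
   endpoint of [y] at [N] is at most the one at [n]. *)
pose N := maxn m n.
rewrite (@phi_compactE _ _ N); last by move=> i; rewrite geq_max => /andP[/ym].
rewrite phi_partial_sum.
apply: (@le_trans _ _ ((prefix_value y N).+1%:R / (prefix_card N)%:R)).
  by rewrite ler_pM2r ?invr_gt0 ?ltr0n ?(leq_ltn_trans _ (prefix_card_gt N))// ler_nat.
apply: le_trans (prefix_value_upper_nonincr _ (leq_maxr m n)) _.
rewrite ler_pM2r ?invr_gt0// -!natr1 lerD2r.
(* Dividing by [prefix_card n] turns the comparison of prefix values into one of [phi_compact] on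
   truncations, where monotonicity is known. *)
rewrite -[leLHS](divfK (lt0r_neq0 P0)) -[leRHS](divfK (lt0r_neq0 P0)) ler_pM2r//.
rewrite -(truncation_value x) -(truncation_value y) -!phi_partial_sum.
rewrite -!phi_compactE; first 1 last.
- by move=> i ni; rewrite /truncation ltnNge ni.
- by move=> i ni; rewrite /truncation ltnNge ni.
by apply: phi_compact_le => //; [exact: truncation_compact..|exact: truncation_homo].
Qed.

Lemma prefix_card_inv_lt (e : R) : 0 < e -> exists n, (prefix_card n)%:R^-1 < e.
Proof.
move=> e0; exists (Num.bound e^-1); rewrite invf_plt ?posrE//; last first.
  by rewrite ltr0n (leq_ltn_trans _ (prefix_card_gt _)).
apply: lt_trans (archi_boundP _) _; first by rewrite invr_ge0 ltW.
by rewrite ltr_nat prefix_card_gt.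
Qed.

(** On a cylinder of length [n] around [x], [phihat] exceeds its value at [x] by at most the inverse
    of [prefix_card n]. Open lower half-lines generate the Borel sets, so this suffices for
    measurability. *)
Lemma phihat_lt_open (t : R) : open [set x : Cseq k | phihat R x < t].
Proof.
rewrite openE => x /= xt; apply/Cseq_nbhsP.
have [n nt] : exists n, (prefix_card n)%:R^-1 < t - phihat R x.
  by apply: prefix_card_inv_lt; rewrite subr_gt0.
exists n => y yx /=; apply: le_lt_trans (phihat_le _ n) _.
rewrite (eq_prefix_value yx) -natr1 mulrDl mul1r.
apply: (@le_lt_trans _ _ (phihat R x + (prefix_card n)%:R^-1)).
  by rewrite lerD2r phihat_ge.
by rewrite -ltrBrDl.
Qed.

Lemma phihat_measurable :
  measurable_fun [set: borel (Cseq k)] (@phihat R k : borel (Cseq k) -> R).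
Proof.
apply: (measurability _ (RGenInftyO.measurableE R)) => _ [_ [t ->] <-].
rewrite setTI; apply: sub_sigma_algebra.
exact: phihat_lt_open.
Qed.

Lemma prefix_value_lt_measurable n N :
  measurable ([set x | (prefix_value x n < N)%N] : set (borel (Cseq k))).
Proof.
apply: sub_sigma_algebra; rewrite openE => x /= xN; apply/Cseq_nbhsP.
by exists n => y yx /=; rewrite (eq_prefix_value yx).
Qed.

Lemma cylinder_measurable x n : measurable (cylinder x n : set (borel (Cseq k))).
Proof. by apply: sub_sigma_algebra; exact: cylinder_open. Qed.

(** * Haar measure of prefix sets and of sublevel sets of [phihat] *)

Variable mu : probability (borel (Cseq k)) R.
Hypothesis mu_haar : is_normalized_haar mu.

Lemma haar_cylinder x n : mu (cylinder x n) = mu (cylinder 0 n).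
Proof.
have [inv _ _] := mu_haar.
by rewrite -cylinder_shift (inv x _ (cylinder_measurable 0 n)).
Qed.

(** Raising [N] by one adds one disjoint fiber, a translate of [cylinder 0 n]. *)
Lemma haar_prefix_value_lt_mul n N : (N <= prefix_card n)%N ->
  fine (mu [set x | (prefix_value x n < N)%N]) = N%:R * fine (mu (cylinder 0 n)).
Proof.
elim: N => [|N IH] NP.
  by rewrite mul0r (_ : [set x | _] = set0) ?measure0//; apply/seteqP; split.
have [x xN] := prefix_value_surj NP.
have -> : [set x | (prefix_value x n < N.+1)%N] =
    [set x | (prefix_value x n < N)%N] `|` cylinder x n.
  rewrite -prefix_value_fiber xN; apply/seteqP; split=> y /=.
    by rewrite ltnS leq_eqVlt => /predU1P[->|]; [right|left].
  by case=> [/leqW//|->].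
rewrite measureU; last 1 first.
- rewrite -prefix_value_fiber xN; apply/seteqP; split=> y //= -[+ yN].
  by rewrite yN ltnn.
- rewrite fineD ?fin_num_measure//; last 2 first.
  + exact: prefix_value_lt_measurable.
  + exact: cylinder_measurable.
  rewrite IH 1?ltnW// -natr1 mulrDl mul1r.
  by congr (_ + fine _); exact: haar_cylinder.
- exact: prefix_value_lt_measurable.
- exact: cylinder_measurable.
Qed.

Lemma haar_prefix_value_lt n N : (N <= prefix_card n)%N ->
  mu [set x | (prefix_value x n < N)%N] = (N%:R / (prefix_card n)%:R)%:E.
Proof.
move=> NP.
have P0 : (prefix_card n)%:R != 0 :> R.
  by rewrite pnatr_eq0 -lt0n (leq_ltn_trans _ (prefix_card_gt n)).
(* For [N = prefix_card n] the set is the whole group, of measure 1. *)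
have -> : (prefix_card n)%:R^-1 = fine (mu (cylinder 0 n)).
  apply: (mulfI P0); rewrite mulfV// -haar_prefix_value_lt_mul//.
  rewrite (_ : [set x | _] = setT) ?probability_setT//.
  by apply/seteqP; split=> // x _; exact: prefix_value_lt.
rewrite -haar_prefix_value_lt_mul// fineK// fin_num_measure//.
exact: prefix_value_lt_measurable.
Qed.

Lemma haar_phihat_lt (t : R) : 0 <= t -> t <= 1 ->
  mu [set x : Cseq k | phihat R x < t] = t%:E.
Proof.
move=> t0 t1.
have mt : measurable ([set x | phihat R x < t] : set (borel (Cseq k))).
  by apply: sub_sigma_algebra; exact: phihat_lt_open.
have approx n : `|fine (mu [set x : Cseq k | phihat R x < t]) - t| <=
    2 * (prefix_card n)%:R^-1.
  have P0 : 0 < (prefix_card n)%:R :> R.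
    by rewrite ltr0n (leq_ltn_trans _ (prefix_card_gt n)).
  (* [N] is the integer part of [t * prefix_card n]. *)
  have /andP[] := truncn_itv (mulr_ge0 t0 (ltW P0)).
  set N := Num.truncn _ => Nt tN.
  have NP : (N <= prefix_card n)%N.
    by rewrite -(ler_nat R) (le_trans Nt)// ler_piMl// ltW.
  (* The predecessor leaves room for the right endpoint: a prefix value below [N.-1] has its
     successor strictly below [N]. *)
  have lower : ((N.-1%:R / (prefix_card n)%:R)%:E <=
      mu [set x : Cseq k | (phihat R x < t)%R])%E.
    rewrite -haar_prefix_value_lt; last exact: leq_trans (leq_pred _) NP.
    apply: le_measure; rewrite ?inE//; first exact: prefix_value_lt_measurable.
    move=> x /= xN; apply: le_lt_trans (phihat_le x n) _.
    rewrite ltr_pdivrMr//; apply: lt_le_trans Nt; rewrite ltr_nat.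
    by move: xN; rewrite ltn_predRL.
  have upper : (mu [set x : Cseq k | (phihat R x < t)%R] <=
      (N.+1%:R / (prefix_card n)%:R)%:E)%E.
    have [NP1|] := leqP N.+1 (prefix_card n).
      rewrite -haar_prefix_value_lt//; apply: le_measure; rewrite ?inE//.
        exact: prefix_value_lt_measurable.
      move=> x /= xt; rewrite -(ltr_nat R); apply: le_lt_trans tN.
      by rewrite -ler_pdivrMr// (le_trans (phihat_ge x n))// ltW.
    (* When [N] reaches [prefix_card n], as for [t = 1], the bound is at least 1 and holds for any
       probability. *)
    move=> /ltnW PN; apply: le_trans (probability_le1 mu mt) _.
    by rewrite lee_fin ler_pdivlMr// mul1r ler_nat.
  move: lower upper; rewrite -[mu _]fineK ?fin_num_measure// !lee_fin.
  rewrite ler_pdivrMr// ler_pdivlMr// => lower upper.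
  rewrite -ler_pdivrMr ?invr_gt0// invrK -(gtr0_norm P0) -normrM.
  rewrite mulrBl ler_norml; apply/andP.
  (* An inequality, since [N.-1] is 0 when [N] is 0. The lower bound loses less than 2 units and the
     upper at most 1, hence the constant 2. *)
  have NN : N%:R <= N.-1%:R + 1 :> R by rewrite natr1 ler_nat leqSpred.
  move: upper tN; rewrite -!natr1 => upper tN; split; lra.
rewrite -[LHS]fineK ?fin_num_measure//; congr EFin; apply/eqP.
rewrite -subr_eq0 -normr_le0 leNgt; apply/negP => d0.
have [n] := prefix_card_inv_lt (divr_gt0 d0 (ltr0n R 2)).
rewrite ltr_pdivlMr// mulrC ltNge => /negP; apply; exact: approx.
Qed.

(** * Comparison of the image measure with Lebesgue measure restricted to the unit interval *)

Lemma pushforward_haar_itv (t : R) :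
  pushforward mu (@phihat R k : borel (Cseq k) -> R) `]-oo, t[ =
  mrestr lebesgue_measure (measurable_itv `[(0 : R), 1]) `]-oo, t[.
Proof.
rewrite /pushforward /mrestr.
have -> : @phihat R k @^-1` `]-oo, t[ = [set x : Cseq k | phihat R x < t].
  by apply/seteqP; split=> x /=; rewrite in_itv.
have range01 x : 0 <= phihat R x <= 1 by have := phihat_itv R k_gt1 x; rewrite in_itv.
have [t0|t0] := leP t 0.
  rewrite (_ : [set x | _] = set0) ?measure0; last first.
    apply/seteqP; split=> x //= xt; have /andP[x0 _] := range01 x.
    by have := lt_le_trans xt (le_trans t0 x0); rewrite ltxx.
  rewrite (_ : _ `&` _ = set0) ?measure0//; apply/seteqP; split=> x //=.
  by rewrite !in_itv/= => -[xt /andP[x0 _]]; have := lt_le_trans xt (le_trans t0 x0); rewrite ltxx.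
have [t1|t1] := leP t 1.
  rewrite haar_phihat_lt ?(ltW t0)// (_ : _ `&` _ = `[0, t[%classic); last first.
    apply/seteqP; split=> x /=; rewrite !in_itv/=.
      by move=> [-> /andP[->]].
    by move=> /andP[-> xt]; rewrite xt (ltW (lt_le_trans xt t1)).
  by rewrite lebesgue_measure_itv/= lte_fin t0 oppr0 adde0.
rewrite (_ : [set x | _] = setT) ?probability_setT; last first.
  by apply/seteqP; split=> x //= _; have /andP[_ x1] := range01 x; exact: le_lt_trans t1.
rewrite setIidr => [|x /=]; first by rewrite lebesgue_measure_itv/= lte_fin ltr01 oppr0 adde0.
by rewrite !in_itv/= => /andP[_ x1]; exact: le_lt_trans t1.
Qed.

(** Uniqueness of measures: the half-lines are stable under intersection, generate the Borel sets,
    and countably many of them, each of finite measure, exhaust the line. *)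
Lemma pushforward_haar (A : set R) : measurable A ->
  pushforward mu (@phihat R k : borel (Cseq k) -> R) A =
  lebesgue_measure (A `&` `[0, 1]).
Proof.
move=> mA.
have mphi : measurable_fun [set: borel (Cseq k)]
    (@phihat R k : _ -> measurableTypeR R) by exact: phihat_measurable.
pose phi : {mfun borel (Cseq k) >-> measurableTypeR R} :=
  HB.pack (@phihat R k) (isMeasurableFun.Build _ _ _ _ _ mphi).
pose rho : {measure set (measurableTypeR R) -> \bar R} :=
  mrestr lebesgue_measure (measurable_itv `[(0 : R), 1]).
apply: (@measure_unique _ R (measurableTypeR R) (@RGenInftyO.G R)
  (fun n => `]-oo, n%:R[%classic) (RGenInftyO.measurableE R) _ _ _
  (distribution mu phi) rho) => //.
- move=> _ _ [s ->] [t ->]; exists (Num.min s t).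
  by apply/seteqP; split=> x /=; rewrite !in_itv/= lt_min => /andP.
- by move=> n; exists n%:R.
- rewrite -subTset => x _; exists (Num.bound `|x|) => //=.
  by rewrite in_itv/= (le_lt_trans (ler_norm x))// archi_boundP.
- by move=> _ [t ->]; exact: pushforward_haar_itv.
- by move=> n; apply: (le_lt_trans (probability_le1 (distribution mu phi) _)); rewrite ?ltry.
Qed.

End prefix.

Theorem theorem6 (R : realType) (k : nat -> nat)
    (k_gt1 : forall i, (1 < k i)%N)
    (mu : probability (borel (Cseq k)) R) (mu_haar : is_normalized_haar mu)
    (U : set R) (U01 : U `<=` `[0, 1]%classic)
    (oU : open (U : set (subspace `[0, 1]%classic))) :
  lebesgue_measure U = mu (@phihat R k @^-1` U).
Proof.
have mU : measurable U.
  (* A relatively open set is the trace of an open set of the line, hence Borel. *)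
  have [V oV] := (open_subspaceP `[(0 : R), 1]%classic U).1 oU.
  rewrite (setIidl U01) => <-.
  by apply: measurableI; [exact: open_measurable|exact: measurable_itv].
by rewrite -[in LHS](setIidl U01) -(pushforward_haar k_gt1 mu_haar mU).
Qed.
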